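(* Let $(\mathcal{A},\mathcal{B},E,E')$ be an operator-valued infinitesimal (OVI) probability space, let $N\in\mathbb{N}$, and let $(\mathcal{A}_i)_{i\in I}$ be unital subalgebras of $\mathcal{A}$ containing $\mathcal{B}$. Then $(\mathcal{A}_i)_{i\in I}$ are infinitesimally free with respect to $(E,E')$ if and only if $(M_N(\mathcal{A}_i))_{i\in I}$ are infinitesimally free with respect to $(E^{(N)},E^{(N)'})$ in the OVI probability space $(M_N(\mathcal{A}),M_N(\mathcal{B}),E^{(N)},E^{(N)'})$.
   Context: All algebras are over $\mathbb{C}$. An OVI probability space $(\mathcal{A},\mathcal{B},E,E')$ consists of a unital algebra $\mathcal{A}$, a unital subalgebra $\mathcal{B}$, a linear map $E:\mathcal{A}\to\mathcal{B}$ with $E(b)=b$ and $E(b_1ab_2)=b_1E(a)b_2$, and a linear map $E':\mathcal{A}\to\mathcal{B}$ with $E'(1)=0$ and $E'(b_1ab_2)=b_1E'(a)b_2$, for all $b,b_1,b_2\in\mathcal{B}$, $a\in\mathcal{A}$. Subalgebras $(\mathcal{A}_i)_{i\in I}$ of $\mathcal{A}$ containing $\mathcal{B}$ are infinitesimally free with respect to $(E,E')$ if for all $n\ge1$, all $i_1,\dots,i_n\in I$ with $i_1\neq i_2\neq\cdots\neq i_n$ (consecutive indices distinct) and all $a_j\in\mathcal{A}_{i_j}$ with $E(a_j)=0$, one has $E(a_1\cdots a_n)=0$ and $E'(a_1\cdots a_n)=\sum_{j=1}^nE(a_1\cdots a_{j-1}E'(a_j)a_{j+1}\cdots a_n)$.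 $E^{(N)}=\mathrm{Id}_N\otimes E$ and $E^{(N)'}=\mathrm{Id}_N\otimes E'$ are the entrywise applications of $E$ and $E'$ to matrices in $M_N(\mathcal{A})$, with values in $M_N(\mathcal{B})$. *)

(* Defs.v *)
From HB Require Import structures.
From mathcomp Require Import all_boot all_order all_algebra.
From mathcomp Require Export reals complex.
Set Implicit Arguments.
Unset Strict Implicit.
Unset Printing Implicit Defensive.
Import GRing.Theory.
Local Open Scope ring_scope.

(* The K-algebra M_{N+1}(A) of a K-algebra A.  An alias of 'M[A]_N.+1 is
   needed because the library's scaling on 'M[A]_N.+1 is by elements of A;
   here the scalars are those of K, acting entrywise.  The ring structure is
   the library's. *)
Definition mx_alg (K : fieldType) (A : algType K) (N : nat) : Type :=
  'M[A]_N.+1.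

Section MatrixAlgebra.
Variables (K : fieldType) (A : algType K) (N : nat).

HB.instance Definition _ := GRing.NzRing.copy (mx_alg A N) 'M[A]_N.+1.

Definition mx_alg_scale (c : K) (M : mx_alg A N) : mx_alg A N :=
  map_mx (fun a : A => c *: a) M.

Fact mx_alg_scaleA a b (M : mx_alg A N) :
  mx_alg_scale a (mx_alg_scale b M) = mx_alg_scale (a * b) M.
Proof. by apply/matrixP=> i j; rewrite !mxE scalerA. Qed.

Fact mx_alg_scale1 : left_id 1 mx_alg_scale.
Proof. by move=> M; apply/matrixP=> i j; rewrite !mxE scale1r. Qed.

Fact mx_alg_scaleDr : right_distributive mx_alg_scale +%R.
Proof. by move=> c M P; apply/matrixP=> i j; rewrite !mxE scalerDr. Qed.

Fact mx_alg_scaleDl (M : mx_alg A N) :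
  {morph mx_alg_scale^~ M : a b / a + b}.
Proof. by move=> a b; apply/matrixP=> i j; rewrite !mxE scalerDl. Qed.

HB.instance Definition _ := GRing.Zmodule_isLmodule.Build K (mx_alg A N)
  mx_alg_scaleA mx_alg_scale1 mx_alg_scaleDr mx_alg_scaleDl.

Fact mx_alg_scaleAl (c : K) (M P : mx_alg A N) : c *: (M * P) = c *: M * P.
Proof.
apply/matrixP=> i j; rewrite !mxE scaler_sumr.
by apply: eq_bigr => k _; rewrite !mxE scalerAl.
Qed.

HB.instance Definition _ :=
  GRing.Lmodule_isLalgebra.Build K (mx_alg A N) mx_alg_scaleAl.

Fact mx_alg_scaleAr (c : K) (M P : mx_alg A N) : c *: (M * P) = M * (c *: P).
Proof.
apply/matrixP=> i j; rewrite !mxE scaler_sumr.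
by apply: eq_bigr => k _; rewrite !mxE scalerAr.
Qed.

HB.instance Definition _ :=
  GRing.Lalgebra_isAlgebra.Build K (mx_alg A N) mx_alg_scaleAr.

Definition mx_pred (B : subalgClosed A) : {pred mx_alg A N} :=
  fun M => M \is a mxOver B.

Fact mx_pred_subproof (B : subalgClosed A) : subalg_closed (mx_pred B).
Proof.
split=> [|c M P|M P]; rewrite /in_mem /= /mx_pred.
- by apply/mxOverP=> i j; rewrite mxE rpredMn ?rpred1.
- move=> /mxOverP MB /mxOverP PB; apply/mxOverP=> i j.
  by rewrite !mxE rpredD ?rpredZ.
- move=> /mxOverP MB /mxOverP PB; apply/mxOverP=> i j.
  by rewrite !mxE rpred_sum // => k _; rewrite rpredM.
Qed.

HB.instance Definition _ (B : subalgClosed A) :=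
  GRing.isSubalgClosed.Build K (mx_alg A N) (mx_pred B) (mx_pred_subproof B).

Definition mx_sub (B : subalgClosed A) : subalgClosed (mx_alg A N) :=
  mx_pred B.

Definition mx_fun (f : A -> A) : mx_alg A N -> mx_alg A N := map_mx f.

Fact mx_fun_subproof (f : {linear A -> A}) : linear (mx_fun f).
Proof. by move=> c M P; apply/matrixP=> i j; rewrite !mxE linearP. Qed.

HB.instance Definition _ (f : {linear A -> A}) :=
  GRing.isLinear.Build K (mx_alg A N) (mx_alg A N) _ (mx_fun f)
    (mx_fun_subproof f).

Definition mx_lin (f : {linear A -> A}) :
  {linear mx_alg A N -> mx_alg A N} := mx_fun f.

End MatrixAlgebra.

(* Maps to the subalgebra B are rendered as endomaps of A with values in B. *)
Record ovi_axioms (K : fieldType) (A : algType K) (B : subalgClosed A)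
    (E E' : {linear A -> A}) : Prop := OviAxioms {
  ovi_E_in : forall a, E a \in B;
  ovi_E_id : forall b, b \in B -> E b = b;
  ovi_E_bimod : forall b1 a b2, b1 \in B -> b2 \in B ->
    E (b1 * a * b2) = b1 * E a * b2;
  ovi_E'_in : forall a, E' a \in B;
  ovi_E'_1 : E' 1 = 0;
  ovi_E'_bimod : forall b1 a b2, b1 \in B -> b2 \in B ->
    E' (b1 * a * b2) = b1 * E' a * b2
}.

Record ovi_space (K : fieldType) := OviSpace {
  ovi_alg :> algType K;
  ovi_base : subalgClosed ovi_alg;
  ovi_E : {linear ovi_alg -> ovi_alg};
  ovi_E' : {linear ovi_alg -> ovi_alg};
  ovi_ax : ovi_axioms ovi_base ovi_E ovi_E'
}.

Section MatrixSpace.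
Variables (K : fieldType) (S : ovi_space K) (N : nat).

Fact mx_bimod (f : {linear S -> S}) :
    (forall b1 a b2, b1 \in ovi_base S -> b2 \in ovi_base S ->
       f (b1 * a * b2) = b1 * f a * b2) ->
  forall b1 (a : mx_alg S N) b2,
    b1 \in mx_sub N (ovi_base S) ->
    b2 \in mx_sub N (ovi_base S) ->
    mx_fun f (b1 * a * b2) = b1 * mx_fun f a * b2.
Proof.
move=> fM b1 a b2 /mxOverP b1B /mxOverP b2B; apply/matrixP=> i j.
rewrite !mxE raddf_sum; apply: eq_bigr => k _.
rewrite !mxE !mulr_suml raddf_sum; apply: eq_bigr => l _.
by rewrite !mxE; exact: fM.
Qed.

Fact mx_ovi_subproof :
  ovi_axioms (mx_sub N (ovi_base S)) (mx_lin N (ovi_E S)) (mx_lin N (ovi_E' S)).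
Proof.
case: (ovi_ax S) => Ein Eid EM E'in E'1 E'M; split.
- by move=> a; apply/mxOverP=> i j; rewrite mxE.
- by move=> b /mxOverP bB; apply/matrixP=> i j; rewrite mxE Eid.
- exact: mx_bimod.
- by move=> a; apply/mxOverP=> i j; rewrite mxE.
- by apply/matrixP=> i j; rewrite !mxE raddfMn [X in X *+ _]E'1 mul0rn.
- exact: mx_bimod.
Qed.

(* (M_{N+1}(A), M_{N+1}(B), E^(N+1), E^(N+1)') *)
Definition mx_ovi : ovi_space K := OviSpace mx_ovi_subproof.

Definition mx_subalg (B : subalgClosed S) : subalgClosed mx_ovi :=
  mx_sub N B.

Fact mx_subalgS (B : subalgClosed S) :
  {subset ovi_base S <= B} -> {subset ovi_base mx_ovi <= mx_subalg B}.
Proof. exact: mxOverS. Qed.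

End MatrixSpace.

(* Indices range over 'I_n, hence are 0-based; \prod is the ordered product.
   The subalgebras are meant to contain ovi_base S. *)
Definition infinitesimally_free (K : fieldType) (S : ovi_space K) (I : Type)
    (Ai : I -> subalgClosed S) : Prop :=
  forall (n : nat) (i : 'I_n -> I) (a : 'I_n -> S),
    (1 <= n)%N ->
    (forall j k : 'I_n, k = j.+1 :> nat -> i j <> i k) ->
    (forall j, a j \in Ai (i j)) ->
    (forall j, ovi_E S (a j) = 0) ->
    ovi_E S (\prod_(j < n) a j) = 0 /\
    ovi_E' S (\prod_(j < n) a j) =
      \sum_(j < n)
        ovi_E S (\prod_(k < n) (if k == j then ovi_E' S (a k) else a k)).

(* Main.v *)
Require Import Defs.
From mathcomp Require Import all_boot all_order all_algebra.
Local Open Scope ring_scope.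

(** Both directions transport an alternating product between [S] and its
    matrix space, one entry at a time.

    From [S] to matrices: each entry of a product of [n] matrices is a sum of
    products of entries, indexed by the paths of matrix positions
    [(p, k_1), (k_1, k_2), ..., (k_(n-1), q)] ([prod_mx_edge_walks]). This
    set of paths depends on [n], [p], [q] only, not on the matrices. A matrix
    is centred for the entrywise expectation exactly when all its entries are,
    so along each path freeness in [S] applies; summing over the paths gives
    the identity for the entry. The right-hand side of the infinitesimal
    condition is recovered because replacing the [j]-th matrix by its image
    under the entrywise derivative functional replaces the [j]-th factor along
    every path, and the same paths expand the modified product.

    From matrices to [S]: [a |-> a%:M] is a ring morphism which intertwines
    every linear map with its entrywise extension ([mx_fun_scalar]), so it
    turns the freeness condition for scalar matrices into that for their
    diagonal entry. *)

(** The paths are kept as lists of edges rather than of vertices: consecutive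
    edges match by construction, so no endpoint condition has to be carried
    through the expansion. *)
Fixpoint edge_walks (m n : nat) (p q : 'I_m) : seq ('I_n -> 'I_m * 'I_m) :=
  if n is n'.+1 then
    [seq fun j => if unlift ord0 j is Some j' then e j' else (p, k)
       | k <- enum 'I_m, e <- edge_walks m n' k q]
  else if p == q then [:: fun=> (p, q)] else [::].

(** The index list is the same for every family of matrices: that is what
    lets one expansion serve both for a product and for the same product with
    one factor modified. *)
Lemma prod_mx_edge_walks (A : nzRingType) (m n : nat)
    (M : 'I_n -> 'M[A]_m.+1) (p q : 'I_m.+1) :
  (\prod_(j < n) M j) p q =
  \sum_(e <- edge_walks m.+1 n p q) \prod_(j < n) M j (e j).1 (e j).2.
Proof.
elim: n M p => [|n IHn] M p /=.
  rewrite big_ord0 mxE; case: eqP => _; last by rewrite big_nil.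
  by rewrite big_seq1 big_ord0.
rewrite big_ord_recl mxE big_allpairs_dep /= big_enum /=.
apply: eq_bigr => k _; rewrite IHn GRing.mulr_sumr.
apply: eq_bigr => e _; rewrite big_ord_recl unlift_none /=.
by congr (_ * _); apply: eq_bigr => j _; rewrite liftK.
Qed.

Lemma mx_fun_scalar (K : fieldType) (A : algType K) (N : nat)
    (f : {linear A -> A}) (a : A) :
  mx_fun f (a%:M : mx_alg A N) = (f a)%:M.
Proof. by apply/matrixP=> r s; rewrite !mxE GRing.raddfMn. Qed.

(** Along a walk [e], the entries [M j (e j).1 (e j).2] are centred and lie in
    the same subalgebras as the matrices, with the same alternating indices.
    Multilinearity of both sides of the freeness identities then does the
    rest. *)
Lemma infinitesimally_free_mx (K : fieldType) (S : ovi_space K) (N : nat)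
    (I : Type) (Ai : I -> subalgClosed S) :
  infinitesimally_free Ai ->
  infinitesimally_free (fun i : I => mx_subalg N (Ai i)).
Proof.
move=> freeA n i M n_gt0 alt_i M_in EM0.
have M_entry j r s : M j r s \in Ai (i j) by move/mxOverP: (M_in j); apply.
have E_entry j r s : ovi_E S (M j r s) = 0.
  by move/matrixP/(_ r s): (EM0 j); rewrite !mxE.
have free_walk (e : 'I_n -> 'I_N.+1 * 'I_N.+1) :=
  freeA n i (fun j => M j (e j).1 (e j).2) n_gt0 alt_i
    (fun j => M_entry j _ _) (fun j => E_entry j _ _).
split; apply/matrixP=> p q.
  rewrite !mxE prod_mx_edge_walks GRing.raddf_sum /=.
  by apply: big1 => e _; case: (free_walk e).
rewrite summxE mxE prod_mx_edge_walks GRing.raddf_sum /=.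
under eq_bigr => e _ do rewrite (free_walk e).2.
(* For a fixed modified position [j], the walks reassemble into one matrix
   product. *)
rewrite exchange_big /=; apply: eq_bigr => j _.
rewrite mxE prod_mx_edge_walks GRing.raddf_sum /=; apply: eq_bigr => e _.
congr (ovi_E S _); apply: eq_bigr => k _.
by case: ifP; rewrite ?mxE.
Qed.

(** Scalar matrices form a copy of [S] inside its matrix space, compatible
    with products, subalgebras and both functionals; the condition there is
    read off at the corner entry, which exists as the size is positive. *)
Lemma infinitesimally_free_of_mx (K : fieldType) (S : ovi_space K) (N : nat)
    (I : Type) (Ai : I -> subalgClosed S) :
  infinitesimally_free (fun i : I => mx_subalg N (Ai i)) ->
  infinitesimally_free Ai.
Proof.
move=> freeM n i a n_gt0 alt_i a_in Ea0.
have prod_scalar (b : 'I_n -> S) :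
    \prod_(j < n) ((b j)%:M : mx_ovi S N) = (\prod_(j < n) b j)%:M.
  by rewrite (GRing.rmorph_prod (@scalar_mx S N.+1)).
have scalar00 (x : S) : (x%:M : 'M[S]_N.+1) ord0 ord0 = x by rewrite mxE.
have a_inM j : ((a j)%:M : mx_ovi S N) \in mx_subalg N (Ai (i j)).
  by apply/mxOverP=> r s; rewrite mxE GRing.rpredMn.
have EaM0 j : ovi_E (mx_ovi S N) (a j)%:M = 0.
  by rewrite [LHS]mx_fun_scalar Ea0; exact: GRing.raddf0.
have [E0 E'sum] := freeM n i (fun j => (a j)%:M) n_gt0 alt_i a_inM EaM0.
rewrite prod_scalar [LHS]mx_fun_scalar in E0.
rewrite prod_scalar [LHS]mx_fun_scalar in E'sum.
split; first by move/matrixP/(_ ord0 ord0): E0; rewrite scalar00 mxE.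
move/matrixP/(_ ord0 ord0): E'sum; rewrite scalar00 summxE => ->.
apply: eq_bigr => j _.
rewrite (_ : \prod_(k < n) _ =
    (\prod_(k < n) (if k == j then ovi_E' S (a k) else a k))%:M).
  by rewrite [X in fun_of_matrix X]mx_fun_scalar scalar00.
rewrite -prod_scalar; apply: eq_bigr => k _.
by case: ifP => // _; exact: mx_fun_scalar.
Qed.

Theorem proposition3p10 (R : realType) (S : ovi_space R[i]) (N : nat)
    (I : Type) (Ai : I -> subalgClosed S)
    (hAi : forall i : I, {subset ovi_base S <= Ai i}) :
  infinitesimally_free Ai <->
  infinitesimally_free (fun i : I => mx_subalg N (Ai i)).
Proof.
by split; [exact: infinitesimally_free_mx | exact: infinitesimally_free_of_mx].
Qed.
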